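(* Let $n,k,l$ be positive integers, let $A\in\mathbb{Z}^{k\times l}$, $b\in\mathbb{Z}^k$, $w\in\mathbb{Z}^l$ (integer representatives of data over $\mathbb{Z}_n$), and let $p_1,\dots,p_r$ be the distinct prime divisors of $n$. Let $P\in\mathbb{Z}^{k\times k}$ and $Q\in\mathbb{Z}^{(k+l)\times(k+l)}$ be unimodular with $P[A,-nI]Q=[S,0]$ in Smith form, where $S$ is the $k\times k$ nonsingular diagonal matrix of invariant factors of $[A,-nI]$. Put $\tilde b=Pb$, and partition $Q=\begin{bmatrix} Q_0 & Q_1 \\ Q_2 & Q_3 \end{bmatrix}$ with $Q_0\in\mathbb{Z}^{l\times k}$, $Q_1\in\mathbb{Z}^{l\times l}$. Let $\begin{bmatrix} w_0 \\ w_1 \end{bmatrix}=Q^T\begin{bmatrix} w \\ 0 \end{bmatrix}$ with $w_0\in\mathbb{Z}^k$, $w_1\in\mathbb{Z}^l$, and $x_0=S^{-1}\tilde b\in\mathbb{Q}^k$. Then there exists $x$ with $Ax\equiv b \pmod n$ and $\langle w,x\rangle$ coprime to $n$ if and only if both of the following hold: 1. $x_0$ is integral; 2. for every $j=1,\dots,r$, if $\langle w_0,x_0\rangle\equiv 0\pmod{p_j}$ then $w_1\not\equiv 0\pmod{p_j}$. When these conditions hold, all such solutions $x$ are of the form $x=(Q_0x_0+Q_1x_1)\bmod n$ with $x_1\in\mathbb{Z}^l$, and a solution is obtained by choosing $x_1$ as follows: (a) if $\langle w_0,x_0\rangle\not\equiv 0\pmod{p_j}$ for all $j$, take $x_1=0$;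 (b) if $\langle w_0,x_0\rangle\equiv 0\pmod{p_j}$ for some $j$, then for each such $j$ choose $x_{1j}$ with $\langle w_1,x_{1j}\rangle\not\equiv 0\pmod{p_j}$, and take $x_1$ with $x_1\equiv x_{1j}\pmod{p_j}$ for all such $j$ and $x_1\equiv 0\pmod{p_j}$ for all $j$ with $\langle w_0,x_0\rangle\not\equiv 0\pmod{p_j}$.
   Context: $\langle u,v\rangle=\sum_i u_iv_i$. $I$ is the $k\times k$ identity and $[A,-nI]$ is the $k\times(k+l)$ block matrix. An integer square matrix is unimodular if its determinant is $\pm1$. The matrix $[S,0]$ is in Smith form if $S=\mathrm{diag}(f_1,\dots,f_k)$ with positive integers satisfying $f_1\mid f_2\mid\dots\mid f_k$ (the invariant factors). A vector is $\equiv 0$ modulo $p$ if all its entries are divisible by $p$. *)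

(* Defs.v *)
From mathcomp Require Import all_boot all_order all_algebra.

Set Implicit Arguments.
Unset Strict Implicit.
Unset Printing Implicit Defensive.

Import Order.TTheory GRing.Theory Num.Theory.
Local Open Scope ring_scope.

Definition dotv (R : pzRingType) (m : nat) (u v : 'cV[R]_m) : R :=
  \sum_i u i 0 * v i 0.

Definition unimodular (m : nat) (M : 'M[int]_m) : Prop :=
  \det M = 1 \/ \det M = -1.

(* The matrix [S, 0] is in Smith form, stated on its square block S. *)
Definition smith_block (k : nat) (S : 'M[int]_k) : Prop :=
  exists f : 'rV[int]_k,
    [/\ S = diag_mx f,
        forall i, 0 < f 0 i
      & forall i j : 'I_k, j = i.+1 :> nat -> (f 0%R i %| f 0%R j)%Z].

Definition eqmodv (m : nat) (d : int) (u v : 'cV[int]_m) : Prop :=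
  forall i, (u i 0%R = v i 0%R %[mod d])%Z.

Definition zeromodv (m : nat) (d : int) (u : 'cV[int]_m) : Prop :=
  forall i, (d %| u i 0%R)%Z.

(* Entrywise least nonnegative residues (for d > 0). *)
Definition modv (m : nat) (d : int) (u : 'cV[int]_m) : 'cV[int]_m :=
  map_mx (fun z => (z %% d)%Z) u.

(* A rational q is 0 modulo p when it is an integer multiple of p; for
   integral q this is ordinary divisibility. *)
Definition zeromodq (p : nat) (q : rat) : Prop :=
  exists m : int, q = (p%:Z * m)%:~R.

Definition coprime_solution (n k l : nat) (A : 'M[int]_(k, l))
    (b : 'cV[int]_k) (w x : 'cV[int]_l) : Prop :=
  eqmodv n%:Z (A *m x) b /\ coprimez (dotv w x) n%:Z.

Definition ratmx (m1 m2 : nat) (M : 'M[int]_(m1, m2)) : 'M[rat]_(m1, m2) :=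
  map_mx (fun z : int => z%:~R) M.

(* Main.v *)
Require Import Defs.
From mathcomp Require Import all_boot all_order all_algebra.

Set Implicit Arguments.
Unset Strict Implicit.
Unset Printing Implicit Defensive.

Import Order.TTheory GRing.Theory Num.Theory.
Local Open Scope ring_scope.

(* With M = [A, -nI], the integral solutions u of M u = b are the Q v with
   [S, 0] v = P b, that is u = Q (z0; x1) with S z0 = P b and x1 free; on such
   a solution <w, x> = <w0, z0> + <w1, x1>. For a prime p dividing n this can be
   made nonzero modulo p by the choice of x1 unless p divides both <w0, z0> and
   w1, and the Chinese remainder theorem combines the choices. *)

(** * Unimodular and Smith matrices, and the embedding of integer matrices into rational ones *)

Lemma unimodular_unitmx (m : nat) (M : 'M[int]_m) : unimodular M -> M \in unitmx.
Proof. by rewrite unitmxE; case=> ->; rewrite ?unitrN unitr1. Qed.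

(** The cast only renames the row dimension, so [B] inherits a right inverse from [Q]; with [e]
    between variables it can be eliminated. The cast arises because the block form of [Q] splits its
    rows as [l + k] and its columns as [k + l]. *)
Lemma castmx_mul_inv (R : comUnitRingType) (m n : nat) (e : n = m)
    (Q : 'M[R]_n) (B : 'M[R]_(m, n)) :
  Q \in unitmx -> castmx (e, erefl n) Q = B -> exists C, B *m C = 1%:M.
Proof.
case: m / e B => B Qu; rewrite castmx_id => <-.
by exists (invmx Q); rewrite mulmxV.
Qed.

Lemma smith_block_unitmx (k : nat) (S : 'M[int]_k) :
  smith_block S -> ratmx S \in unitmx.
Proof.
case=> f [-> f_gt0 _]; rewrite /ratmx map_diag_mx unitmxE det_diag unitfE.
by apply/prodf_neq0 => i _; rewrite mxE intr_eq0 gt_eqF.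
Qed.

Lemma ratmx_inj (m1 m2 : nat) : injective (@ratmx m1 m2).
Proof.
move=> M N /matrixP eMN; apply/matrixP => i j.
by have /eqP := eMN i j; rewrite !mxE eqr_int => /eqP.
Qed.

(** * Inner products *)

Lemma dotv_trmx (R : pzRingType) (m : nat) (u v : 'cV[R]_m) :
  dotv u v = (u^T *m v) 0 0.
Proof. by rewrite mxE; apply: eq_bigr => i _; rewrite mxE. Qed.

Lemma dotv_col_mx (R : pzRingType) (m1 m2 : nat) (u1 v1 : 'cV[R]_m1)
    (u2 v2 : 'cV[R]_m2) :
  dotv (col_mx u1 u2) (col_mx v1 v2) = dotv u1 v1 + dotv u2 v2.
Proof. by rewrite !dotv_trmx tr_col_mx mul_row_col mxE. Qed.

Lemma dotv_trmx_mul (R : comPzRingType) (m n : nat) (M : 'M[R]_(m, n))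
    (u : 'cV[R]_m) (v : 'cV[R]_n) : dotv (M^T *m u) v = dotv u (M *m v).
Proof. by rewrite !dotv_trmx trmx_mul trmxK mulmxA. Qed.

Lemma dotv0 (R : pzRingType) (m : nat) (u : 'cV[R]_m) : dotv u 0 = 0.
Proof. by rewrite dotv_trmx mulmx0 mxE. Qed.

Lemma dot0v (R : pzRingType) (m : nat) (u : 'cV[R]_m) : dotv 0 u = 0.
Proof. by rewrite dotv_trmx trmx0 mul0mx mxE. Qed.

Lemma dotv_delta (R : pzRingType) (m : nat) (u : 'cV[R]_m) (i : 'I_m) :
  dotv u (delta_mx i 0) = u i 0.
Proof. by rewrite dotv_trmx -colE !mxE. Qed.

Lemma dotvBr (R : pzRingType) (m : nat) (u v1 v2 : 'cV[R]_m) :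
  dotv u (v1 - v2) = dotv u v1 - dotv u v2.
Proof. by rewrite !dotv_trmx mulmxBr !mxE. Qed.

Lemma dotv_ratmx (m : nat) (u v : 'cV[int]_m) :
  dotv (ratmx u) (ratmx v) = (dotv u v)%:~R.
Proof. by rewrite /dotv rmorph_sum; apply: eq_bigr => i _; rewrite !mxE rmorphM. Qed.

(** * Divisibility and congruence of vectors *)

Lemma zeromodq_int (p : nat) (m : int) : zeromodq p m%:~R <-> (p %| m)%Z.
Proof.
split=> [[q /eqP]|/dvdzP[q ->]]; last by exists q; rewrite mulrC.
by rewrite eqr_int => /eqP ->; apply: dvdz_mulr.
Qed.

Lemma zeromodvB (d : int) (m : nat) (u v : 'cV[int]_m) :
  zeromodv d u -> zeromodv d v -> zeromodv d (u - v).
Proof. by move=> du dv i; rewrite !mxE rpredB. Qed.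

Lemma zeromodv_mul (d : int) (m n : nat) (M : 'M[int]_(m, n)) (u : 'cV[int]_n) :
  zeromodv d u -> zeromodv d (M *m u).
Proof. by move=> du i; rewrite mxE; apply: rpred_sum => j _; apply: dvdz_mull. Qed.

Lemma zeromodv_dotv (d : int) (m : nat) (u v : 'cV[int]_m) :
  zeromodv d v -> (d %| dotv u v)%Z.
Proof. by move=> dv; rewrite dotv_trmx; apply: zeromodv_mul. Qed.

Lemma eqmodv_sub (d : int) (m : nat) (u v : 'cV[int]_m) :
  eqmodv d u v <-> zeromodv d (u - v).
Proof.
split=> uv i; first by rewrite !mxE -eqz_mod_dvd; apply/eqP/uv.
by apply/eqP; rewrite eqz_mod_dvd; have := uv i; rewrite !mxE.
Qed.

Lemma eqmodv_dotv (d : int) (m : nat) (u v1 v2 : 'cV[int]_m) :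
  eqmodv d v1 v2 -> (d %| dotv u v1)%Z = (d %| dotv u v2)%Z.
Proof.
move=> /eqmodv_sub /(zeromodv_dotv u); rewrite dotvBr => dv.
by rewrite -[dotv u v1](subrK (dotv u v2)) rpredDl.
Qed.

Lemma eqmodv_modv (d : int) (m : nat) (u : 'cV[int]_m) : eqmodv d (modv d u) u.
Proof. by move=> i; rewrite mxE modz_mod. Qed.

(** A standard basis vector picks out an entry of [u] that [d] does not divide. *)
Lemma zeromodv_witness (d : int) (m : nat) (u : 'cV[int]_m) :
  ~ zeromodv d u -> exists v, ~ (d %| dotv u v)%Z.
Proof.
move=> nu; have [/forallP //|] := boolP [forall i, (d %| u i 0%R)%Z].
by case/forallPn=> i /negP ndi; exists (delta_mx i 0); rewrite dotv_delta.
Qed.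

(** * Coprimality tested at primes, and Chinese remaindering *)

Lemma coprimez_primes (n : nat) (m : int) : (0 < n)%N ->
  coprimez m n%:Z <-> (forall p, p \in primes n -> ~ (p%:Z %| m)%Z).
Proof.
move=> n_gt0; rewrite /coprimez /gcdz absz_nat; split=> [/eqP[cop] p|ndvd].
  rewrite mem_primes => /and3P[p_pr _ dvpn] /dvdzP[q mE].
  have : (p %| gcdn `|m| n)%N by rewrite dvdn_gcd dvpn mE abszM absz_nat dvdn_mull.
  by rewrite cop dvdn1 => /eqP p1; rewrite p1 in p_pr.
rewrite eqz_nat; apply/negPn/negP => g_neq1.
(* The gcd is nonzero because [n] is positive; being different from 1, it has a least prime divisor
   [pdiv], which divides both [m] and [n]. *)
have g_gt1 : (1 < gcdn `|m| n)%N by rewrite ltn_neqAle eq_sym g_neq1 gcdn_gt0 n_gt0 orbT.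
have := pdiv_dvd (gcdn `|m| n); rewrite dvdn_gcd => /andP[dvm dvn].
apply: (ndvd (pdiv (gcdn `|m| n))); last by rewrite dvdzE absz_nat.
by rewrite mem_primes pdiv_prime ?n_gt0.
Qed.

(** Induction on [s]: the product [N] of the primes already treated is coprime to the new prime [p],
    so each entry can be prescribed modulo [p] while kept modulo [N], hence modulo every earlier
    prime. *)
Lemma primes_chinese (m : nat) (s : seq nat) (v : nat -> 'cV[int]_m) :
  uniq s -> all prime s -> 
  exists x, forall p, p \in s -> eqmodv p%:Z x (v p).
Proof.
elim: s => [|p s IHs] /=; first by exists 0.
move=> /andP[p_s s_uniq] /andP[p_pr s_pr]; have [x xP] := IHs s_uniq s_pr.
set N := (\prod_(q <- s) q)%N.
have copNp : coprimez N p.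
  rewrite coprimezE !absz_nat /N big_seq.
  elim/big_ind: _ => [|c d cop_c cop_d|q qs]; first exact: coprime1n.
    by rewrite coprimeMl cop_c.
  have q_pr := allP s_pr q qs; rewrite prime_coprime // dvdn_prime2 //.
  by apply: contraNneq p_s => <-.
exists (\col_i zchinese N p (x i 0) (v p i 0)) => q.
rewrite inE => /predU1P[-> | qs] i; rewrite mxE; first exact: zchinese_modr.
rewrite -(xP q qs); apply/eqP; rewrite eqz_mod_dvd.
apply: (@dvdz_trans N); first by rewrite dvdzE !absz_nat /N (big_rem q qs) dvdn_mulr.
by rewrite -eqz_mod_dvd; apply/eqP/zchinese_modl.
Qed.

(** * Solutions of the system modulo [n] *)

Lemma eqmodv_coprime_solution (n k l : nat) (A : 'M[int]_(k, l)) (b : 'cV[int]_k)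
    (w x y : 'cV[int]_l) : (0 < n)%N -> eqmodv n%:Z x y ->
  coprime_solution n A b w x -> coprime_solution n A b w y.
Proof.
move=> n_gt0 xy [Axb /(coprimez_primes _ n_gt0) cop]; split.
  apply/eqmodv_sub; have /eqmodv_sub Axb0 := Axb; have /eqmodv_sub xy0 := xy.
  have -> : A *m y - b = A *m x - b - A *m (x - y).
    by rewrite mulmxBr opprB [RHS]addrC addrA subrK.
  exact/zeromodvB/zeromodv_mul.
(* Coprimality is tested at one prime [p] of [n] at a time, and a congruence modulo [n] implies one
   modulo [p]. *)
apply/(coprimez_primes _ n_gt0) => p pn; rewrite -(eqmodv_dotv w (v1 := x)).
  exact: cop.
apply/eqmodv_sub => i; apply: (@dvdz_trans n); last by have /eqmodv_sub := xy; apply.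
by move: pn; rewrite mem_primes => /and3P[].
Qed.

(** Turns the congruence into an exact integral system: [y] is the entrywise quotient of
    [A *m x - b] by [n]. *)
Lemma eqmodv_mulmxP (n k l : nat) (A : 'M[int]_(k, l)) (b : 'cV[int]_k)
    (x : 'cV[int]_l) :
  eqmodv n%:Z (A *m x) b <->
  exists y, row_mx A (- (n%:Z)%:M) *m col_mx x y = b.
Proof.
split=> [/eqmodv_sub Axb|[y <-]].
  exists (\col_i ((A *m x - b)%R i 0%R %/ n)%Z); rewrite mul_row_col mulNmx mul_scalar_mx.
  apply/matrixP=> i j; rewrite (ord1 j) {j}; have := divzK (Axb i); rewrite !mxE.
  by rewrite mulrC => ->; rewrite opprB addrC subrK.
apply/eqmodv_sub => i; rewrite mul_row_col mulNmx mul_scalar_mx opprB addrC subrK.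
by rewrite mxE dvdz_mulr.
Qed.

Theorem theorem2 (n k l : nat) (n_gt0 : (0 < n)%N) (k_gt0 : (0 < k)%N)
    (l_gt0 : (0 < l)%N)
    (A : 'M[int]_(k, l)) (b : 'cV[int]_k) (w : 'cV[int]_l)
    (P : 'M[int]_k) (Q : 'M[int]_(k + l)) (S : 'M[int]_k)
    (Q0 : 'M[int]_(l, k)) (Q1 : 'M[int]_(l, l))
    (Q2 : 'M[int]_(k, k)) (Q3 : 'M[int]_(k, l))
    (bt w0 : 'cV[int]_k) (w1 : 'cV[int]_l) (x0 : 'cV[rat]_k)
    (P_unimodular : unimodular P) (Q_unimodular : unimodular Q)
    (Q_blocks : castmx (addnC k l, erefl (k + l)%N) Q = block_mx Q0 Q1 Q2 Q3)
    (PAQ : P *m row_mx A (- (n%:Z)%:M) *m block_mx Q0 Q1 Q2 Q3 = row_mx S 0)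
    (S_smith : smith_block S)
    (btE : bt = P *m b)
    (w01E : col_mx w0 w1 = (block_mx Q0 Q1 Q2 Q3)^T *m col_mx w 0)
    (x0E : x0 = invmx (ratmx S) *m ratmx bt) :
  let w0x0 := dotv (ratmx w0) x0 in
  let conditions :=
    x0 \is a mxOver Num.int /\
    (forall p, p \in primes n -> zeromodq p w0x0 -> ~ zeromodv p%:Z w1) in
  ((exists x : 'cV[int]_l, coprime_solution n A b w x) <-> conditions) /\
  (conditions ->
   exists z0 : 'cV[int]_k,
     [/\ x0 = ratmx z0,
         (forall x : 'cV[int]_l, coprime_solution n A b w x ->
            exists x1 : 'cV[int]_l,
              modv n%:Z x = modv n%:Z (Q0 *m z0 + Q1 *m x1)),
         ((forall p, p \in primes n -> ~ zeromodq p w0x0) ->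
            coprime_solution n A b w (modv n%:Z (Q0 *m z0 + Q1 *m 0)))
       & ((exists2 p, p \in primes n & zeromodq p w0x0) ->
            (forall p, p \in primes n -> zeromodq p w0x0 ->
               exists v : 'cV[int]_l, ~ (p%:Z %| dotv w1 v)%Z) /\
            (forall x1j : nat -> 'cV[int]_l,
               (forall p, p \in primes n -> zeromodq p w0x0 ->
                  ~ (p%:Z %| dotv w1 (x1j p))%Z) ->
               let admissible (x1 : 'cV[int]_l) :=
                 forall p, p \in primes n ->
                   (zeromodq p w0x0 -> eqmodv p%:Z x1 (x1j p)) /\
                   (~ zeromodq p w0x0 -> zeromodv p%:Z x1) in
               (exists x1, admissible x1) /\
               (forall x1, admissible x1 ->
                  coprime_solution n A b w
                    (modv n%:Z (Q0 *m z0 + Q1 *m x1)))))]).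
Proof.
move=> w0x0 conditions; set M := row_mx A _ in PAQ.
set B := block_mx Q0 _ _ _ in PAQ w01E Q_blocks.
have P_unit := unimodular_unitmx P_unimodular.
have S_unit := smith_block_unitmx S_smith.
have [C BC] := castmx_mul_inv (unimodular_unitmx Q_unimodular) Q_blocks.
have BE (z0 : 'cV_k) (x1 : 'cV_l) :
    B *m col_mx z0 x1 = col_mx (Q0 *m z0 + Q1 *m x1) (Q2 *m z0 + Q3 *m x1).
  by rewrite mul_block_col.
(* The zero block of [[S, 0]] removes [x1] from the equation; this is why [x1] is a free
   parameter. *)
have MB (z0 : 'cV_k) (x1 : 'cV_l) : P *m (M *m (B *m col_mx z0 x1)) = S *m z0.
  by rewrite !mulmxA PAQ mul_row_col mul0mx addr0.
(* Since [S] is invertible over the rationals, integrality of [x0] amounts to solvability of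
   [S *m z0 = bt] over the integers. *)
have x0P z0 : x0 = ratmx z0 <-> S *m z0 = bt.
  split=> [x0z|Sz]; last by rewrite x0E -Sz /ratmx map_mxM mulKmx.
  by apply: ratmx_inj; rewrite /ratmx map_mxM -/(ratmx z0) -x0z x0E mulKVmx.
have solP x : eqmodv n%:Z (A *m x) b <->
    exists z0 x1, x0 = ratmx z0 /\ x = Q0 *m z0 + Q1 *m x1.
  split=> [/eqmodv_mulmxP[y Mb]|[z0 [x1 [/x0P Sz ->]]]].
    (* The parameters of a solution are its coordinates in the basis given by the columns of [B],
       read off with the inverse [C]. *)
    exists (usubmx (C *m col_mx x y)), (dsubmx (C *m col_mx x y)).
    have Bu := BE (usubmx (C *m col_mx x y)) (dsubmx (C *m col_mx x y)).
    move: Bu; rewrite vsubmxK mulmxA BC mul1mx => Bu.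
    split; last by case/eq_col_mx: Bu.
    apply/x0P; rewrite -(MB _ (dsubmx (C *m col_mx x y))).
    by rewrite vsubmxK (mulmxA B) BC mul1mx Mb btE.
  apply/eqmodv_mulmxP; exists (Q2 *m z0 + Q3 *m x1); rewrite -BE.
  apply: (can_inj (mulKmx P_unit)).
  by rewrite MB Sz btE.
(* Moving [B] across the inner product turns [(w; 0)] into [(w0; w1)]; the zero padding discards the
   lower half of the solution. *)
have dotE z0 x1 : dotv w (Q0 *m z0 + Q1 *m x1) = dotv w0 z0 + dotv w1 x1.
  by rewrite -dotv_col_mx w01E dotv_trmx_mul BE dotv_col_mx dot0v addr0.
have w0x0P z0 p : x0 = ratmx z0 -> zeromodq p w0x0 <-> (p%:Z %| dotv w0 z0)%Z.
  by rewrite /w0x0 => ->; rewrite dotv_ratmx; exact: zeromodq_int.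
have copP z0 x1 : x0 = ratmx z0 -> coprime_solution n A b w (Q0 *m z0 + Q1 *m x1) <->
    forall p, p \in primes n -> ~ (p%:Z %| dotv w0 z0 + dotv w1 x1)%Z.
  move=> x0z; rewrite /coprime_solution dotE.
  split=> [[_ /(coprimez_primes _ n_gt0)]//|ndv].
  by split; [apply/solP; exists z0, x1 | apply/(coprimez_primes _ n_gt0)].
have modP x : coprime_solution n A b w x -> coprime_solution n A b w (modv n%:Z x).
  by apply: eqmodv_coprime_solution => // i; rewrite eqmodv_modv.
(* Stated before reduction modulo [n] and without assuming that some prime divides [w0x0], so that
   it serves both the existence claim and the recipe (b). *)
have admP z0 (x1j : nat -> 'cV[int]_l) : x0 = ratmx z0 ->
    (forall p, p \in primes n -> zeromodq p w0x0 -> ~ (p%:Z %| dotv w1 (x1j p))%Z) ->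
    let admissible (x1 : 'cV[int]_l) :=
      forall p, p \in primes n ->
        (zeromodq p w0x0 -> eqmodv p%:Z x1 (x1j p)) /\
        (~ zeromodq p w0x0 -> zeromodv p%:Z x1) in
    (exists x1, admissible x1) /\
    (forall x1, admissible x1 -> coprime_solution n A b w (Q0 *m z0 + Q1 *m x1)).
  move=> x0z x1jP; split=> [|x1 x1P].
    have [||x1 x1P] := @primes_chinese l (primes n)
        (* The value 0 encodes the requirement that [x1] vanish modulo the primes that do not divide
           [dotv w0 z0]. *)
        (fun p => if (p%:Z %| dotv w0 z0)%Z then x1j p else 0).
    - exact: primes_uniq.
    - by apply/allP => p; rewrite mem_primes => /andP[].
    exists x1 => p pn; have := x1P p pn.
    case: ifP => [pw|/negP Npw] xp; split=> // /(w0x0P z0 p x0z) //.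
    by move: xp => /eqmodv_sub; rewrite subr0.
  apply/copP => // p pn; have [dvd_p Ndvd_p] := x1P p pn.
  (* In either case [p] divides exactly one of the two summands, hence not their sum. *)
  have [pw|pw] := boolP (p%:Z %| dotv w0 z0)%Z.
    have /(w0x0P z0 p x0z) pq := pw.
    by rewrite rpredDl // (eqmodv_dotv w1 (dvd_p pq)); apply: x1jP.
  apply/negP; rewrite rpredDr //; apply: zeromodv_dotv; apply: Ndvd_p.
  by move=> /(w0x0P z0 p x0z); apply/negP.
have intP : x0 \is a mxOver Num.int -> exists z0, x0 = ratmx z0.
  move=> /mxOverP x0int; exists (map_mx Num.floor x0).
  by apply/matrixP => i j; rewrite !mxE floorK.
have witP : conditions -> forall p, p \in primes n -> zeromodq p w0x0 ->
    exists v, ~ (p%:Z %| dotv w1 v)%Z.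
  by case=> _ cond p pn pq; apply/zeromodv_witness/cond.
have uniqP z0 z0' : x0 = ratmx z0 -> x0 = ratmx z0' -> z0' = z0.
  by move=> -> /ratmx_inj.
split.
  split=> [[x xsol]|cond].
    have [z0 [x1 [x0z xE]]] := (solP x).1 xsol.1.
    split=> [|p pn /(w0x0P z0 p x0z) pw pw1].
      by apply/mxOverP => i j; rewrite x0z mxE.
    (* If [p] divided both [dotv w0 z0] and all of [w1], it would divide the inner product of [w]
       with every solution. *)
    move: xsol; rewrite xE => /(copP _ _ x0z)/(_ p pn); apply.
    rewrite rpredD //; rewrite /dotv; apply: rpred_sum => i _; exact: dvdz_mulr.
  have [z0 x0z] := intP cond.1.
  (* An explicit choice as a function of [p]; the default 0 is reached only when [p] divides all of
     [w1], which condition 2 excludes at the relevant primes. *)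
  pose x1j p : 'cV[int]_l :=
    if [pick i | ~~ (p%:Z %| w1 i 0%R)%Z] is Some i then delta_mx i 0 else 0.
  have [|[x1 x1P] sol] := admP z0 x1j x0z; last by exists (Q0 *m z0 + Q1 *m x1); apply: sol.
  move=> p pn pq; rewrite /x1j; case: pickP => [i /negP|pw]; first by rewrite dotv_delta.
  by case: (cond.2 p pn pq) => i; have /negbFE := pw i.
move=> cond; have [z0 x0z] := intP cond.1; exists z0; split=> //.
(* The parametrization holds exactly, before reduction; its [z0'] must be [z0] because [x0]
   determines it. *)
- move=> x [/solP[z0' [x1 [x0z' ->]]] _]; exists x1.
  by rewrite (uniqP _ _ x0z x0z').
(* Case (a): with [x1 = 0] the inner product is [dotv w0 z0], which no prime of [n] divides. *)
- move=> Nw; apply/modP/copP => // p pn; rewrite dotv0 addr0.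
  by move=> /(w0x0P z0 p x0z); apply: Nw.
move=> _; split=> [|x1j x1jP]; first exact: witP.
by have [exadm sol] := admP z0 x1j x0z x1jP; split=> // x1 x1P; apply/modP/sol.
Qed.
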